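(* Let $H_1,H_2$ be real Hilbert spaces, let $A_1:H_1\to2^{H_1}$ and $A_2:H_2\to2^{H_2}$ be maximal monotone operators and let $K:H_1\to H_2$ be a bounded linear operator such that the problem of finding $x\in H_1$ with $$0\in A_1x+K^*A_2Kx\qquad(\mathrm{P})$$ admits a solution. Let $\sigma\in[0,1)$, let $\tau,\theta>0$ satisfy $\tau\theta\|K\|^2\le1$, let $x^0\in H_1$, $y^0\in H_2$, and let $\{\tilde x^k\}_{k\ge1}$ and $\{\tilde y^k\}_{k\ge1}$ be sequences generated by the inexact Chambolle-Pock method described in the context (with parameters $\sigma,\tau,\theta$ and starting point $(x^0,y^0)$), where it is supposed that the inner loop always ends in a finite number of iterations. Then $\{\tilde u^k:=(\tilde x^k,\tilde y^k)\}$ converges weakly in $H_1\times H_2$ to a solution $u=(x,y)$ of $$0\in A_1x+K^*y,\qquad 0\in-Kx+A_2^{-1}y.$$ In particular, $\{\tilde x^k\}$ converges weakly to a solution of $(\mathrm{P})$.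
   Context: Inexact Chambolle-Pock method. For a maximal monotone operator $T$, $J_T=(I+T)^{-1}$ denotes its resolvent. Let $$\|(x,y)\|_{\mathcal{M}}^2=\frac1\tau\|x\|^2-2\langle Kx,y\rangle+\frac1\theta\|y\|^2,\qquad (x,y)\in H_1\times H_2,$$ which is the squared seminorm induced by $\mathcal{M}=\begin{bmatrix}\frac1\tau I&-K^*\\-K&\frac1\theta I\end{bmatrix}$. Given $(x^k,y^k)$, the inner loop produces pairs $(\tilde x^{k+1},a^{k+1})$ with $a^{k+1}\in A_1\tilde x^{k+1}$ and, for each of them, computes $$\tilde y^{k+1}=J_{\theta A_2^{-1}}\bigl(y^k+\theta K(\tilde x^{k+1}-\tau(a^{k+1}+K^*y^k))\bigr),$$ improving the pair $(\tilde x^{k+1},a^{k+1})$ until the criterion $$\tau^{-1}\|\tau a^{k+1}+\tilde x^{k+1}-(x^k-\tau K^*y^k)\|^2\le\sigma^2\|(\tilde x^{k+1}-x^k,\tilde y^{k+1}-y^k)\|_{\mathcal{M}}^2$$ is satisfied. Then the update is $$x^{k+1}=(x^k-\tau K^*y^k)-\tau a^{k+1},\qquad y^{k+1}=\tilde y^{k+1}.$$ Thus, when every inner loop terminates, the generated sequences are exactly sequences such that for all $k\ge0$: $a^{k+1}\in A_1\tilde x^{k+1}$, $\tilde y^{k+1}$ is given by the resolvent formula above, the displayed error criterion holds, and the update rule holds. (The values $\tilde x^{k+1},\tilde y^{k+1},a^{k+1}$ are those accepted at termination of the inner loop.) *)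

(* Defs.v *)
From HB Require Import structures.
From mathcomp Require Import all_boot all_order all_algebra.
From mathcomp Require Import all_classical all_reals all_analysis.
From mathcomp Require Import ring lra.

Set Implicit Arguments.
Unset Strict Implicit.
Unset Printing Implicit Defensive.

Import Order.TTheory GRing.Theory Num.Theory.
Import numFieldNormedType.Exports.

Local Open Scope classical_set_scope.
Local Open Scope ring_scope.

HB.mixin Record isHilbert (R : realType) H of CompleteNormedModule R H := {
  inner : {dot H for @idfun R} ;
  inner_norm : forall x : H, inner x x = `|x| ^+ 2
}.

#[short(type="hilbertType")]
HB.structure Definition Hilbert (R : realType) :=
  { H of CompleteNormedModule R H & isHilbert R H }.

Section riesz.
Variables (R : realType) (H : hilbertType R).
Implicit Types (x y z : H).

Lemma innerC x y : inner x y = inner y x.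
Proof. by rewrite hermitian_subproof expr0 mul1r. Qed.

Lemma innerDl z x y : inner (x + y) z = inner x z + inner y z.
Proof. exact: linearDl. Qed.

Lemma innerDr z x y : inner z (x + y) = inner z x + inner z y.
Proof. exact: linearDr. Qed.

Lemma innerZl z a x : inner (a *: x) z = a * inner x z.
Proof. exact: linearZl_LR. Qed.

Lemma innerZr z a x : inner z (a *: x) = a * inner z x.
Proof. exact: linearZr_LR. Qed.

Lemma innerNl z x : inner (- x) z = - inner x z.
Proof. exact: linearNl. Qed.

Lemma innerNr z x : inner z (- x) = - inner z x.
Proof. exact: linearNr. Qed.

Let innerE := (innerDl, innerDr, innerZl, innerZr, innerNl, innerNr).

Lemma parallelogram x y :
  `|x - y| ^+ 2 = 2 * `|x| ^+ 2 + 2 * `|y| ^+ 2 - 4 * `|2^-1 *: (x + y)| ^+ 2.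
Proof.
by rewrite -!inner_norm !innerE (innerC y x); field.
Qed.

Lemma riesz (f : {linear H -> R^o}) : continuous f ->
  exists z, forall x, f x = inner x z.
Proof.
move=> cf.
have [c c0 fc] : exists2 c : R, 0 < c & forall x, `|f x| <= c * `|x|.
  have /linear_boundedP /pinfty_ex_gt0 [c c0 fc] :=
    (linear_bounded_continuous f).2 cf.
  by exists c.
have fD x y : f (x + y) = f x + f y by rewrite linearD.
have fZ a x : f (a *: x) = a * f x by rewrite linearZ.
pose J x : R := `|x| ^+ 2 - 2 * f x.
have Jlb x : - c ^+ 2 <= J x.
  have : f x <= c * `|x| := le_trans (ler_norm _) (fc x).
  have := sqr_ge0 (`|x| - c); rewrite /J; nra.
have hinf : has_inf (range J).
  split; first by exists (J 0), 0.
  by exists (- c ^+ 2) => _ [x _ <-]; exact: Jlb.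
pose m := inf (range J).
have mJ x : m <= J x by apply: ge_inf; [exact: hinf.2|exists x].
have /choice[u uJ] : forall n : nat, exists x, J x < m + n.+1%:R^-1.
  move=> n; have [|_ [x _ <-] xJ] := @inf_adherent _ (range J) n.+1%:R^-1 _ hinf.
    by rewrite invr_gt0.
  by exists x.
have Juv x y : `|x - y| ^+ 2 <= 2 * (J x + J y - 2 * m).
  have := mJ (2^-1 *: (x + y)); rewrite {1}/J fZ fD.
  rewrite (parallelogram x y) /J; lra.
have /cauchy_cvg/cvg_ex[z uz] : cauchy (u @ \oo).
  apply/cauchy_ballP => e e0.
  have e20 : 0 < e ^+ 2 / 4 by rewrite divr_gt0 ?exprn_gt0.
  rewrite near_map2; near=> n p => /=.
  rewrite -ball_normE /= -(ltr_pXn2r (n := 2)) ?nnegrE ?normr_ge0 ?ltW //.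
  apply: le_lt_trans (Juv _ _) _.
  have h1 : J (u n) < m + e ^+ 2 / 4.
    apply: lt_trans (uJ n) _; rewrite ltrD2l.
    by near: n; exact: near_infty_natSinv_lt (PosNum e20).
  have h2 : J (u p) < m + e ^+ 2 / 4.
    apply: lt_trans (uJ p) _; rewrite ltrD2l.
    by near: p; exact: near_infty_natSinv_lt (PosNum e20).
  move: (J (u n)) (J (u p)) h1 h2 => a b; lra.
have Jz : J z <= m.
  apply/ler_addgt0Pr => e e0.
  have Juz : J (u n) @[n --> \oo] --> J z.
    apply: cvgB.
      by rewrite expr2; under eq_fun do rewrite expr2; apply: cvgM; exact: cvg_norm.
    by apply: cvgMl_tmp; apply: continuous_cvg => //; exact: cf.
  apply: (cvgr_to_le Juz); near=> n.
  apply/ltW; apply: lt_trans (uJ n) _; rewrite ltrD2l.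
  by near: n; exact: near_infty_natSinv_lt (PosNum e0).
exists z => h; apply/eqP; rewrite -subr_eq0; apply/eqP.
set d := f h - inner h z.
pose q := `|h| ^+ 2; have q0 : 0 <= q by rewrite exprn_ge0.
pose t := d / (q + 1).
have tq : t * (q + 1) = d by rewrite /t divfK// gt_eqF// ltr_wpDl.
have : J z <= J (z + t *: h) by rewrite (le_trans Jz).
rewrite /J -!inner_norm !innerE (innerC z h) fD fZ.
rewrite [inner h h]inner_norm -/q => ineq.
have {ineq} : t * d * 2 <= t ^+ 2 * q by rewrite /d; nra.
rewrite -tq => h1.
have t2 : t ^+ 2 * (q + 2) <= 0 by nra.
have : t ^+ 2 <= 0 by rewrite -(pmulr_lle0 _ (_ : 0 < q + 2))// ltr_wpDl.
by rewrite le_eqVlt ltNge sqr_ge0 orbF sqrf_eq0 => /eqP ->; rewrite mul0r.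
Unshelve. all: by end_near. Qed.

End riesz.

Section bounded_operators.
Variables (R : realType) (H1 H2 : hilbertType R).
Implicit Types K : {linear H1 -> H2}.

Definition opnorm K : R := sup [set `|K x| | x in [set x | `|x| <= 1]].

(* The Hilbert adjoint is chosen by description; adjointP shows that the      *)
(* description is satisfied for bounded K, and it determines adjoint K y.     *)
Definition adjoint K (y : H2) : H1 :=
  xget 0 [set z | forall x, inner (K x) y = inner x z].

Lemma adjointP K : bounded_near K (nbhs (0 : H1)) ->
  forall x y, inner (K x) y = inner x (adjoint K y).
Proof.
move=> /linear_bounded_continuous cK x y.
pose g (x : H1) : R^o := inner (K x) y.
have glin : linear g.
  by move=> a u v; rewrite /g linearP innerDl innerZl.
pose Lg := GRing.isLinear.Build _ _ _ _ g glin.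
pose f : {linear H1 -> R^o} := HB.pack g Lg.
have cf : continuous f.
  apply/linear_bounded_continuous/linear_boundedP.
  have /linear_boundedP /pinfty_ex_gt0 [c c0 Kc] :=
    (linear_bounded_continuous K).2 cK.
  near=> r => u; rewrite /f/= /g.
  have : `|inner (K u) y| <= `|K u| * `|y|.
    rewrite -(ler_pXn2r (n := 2)) ?nnegrE ?mulr_ge0 //.
    rewrite exprMn real_normK ?num_real //.
    set p := inner _ _; set q := `|K u| ^+ 2; set s := `|y| ^+ 2.
    have s0 : 0 <= s by rewrite exprn_ge0.
    have := sqr_ge0 `|s *: K u - p *: y|; rewrite -inner_norm.
    rewrite !(innerDl, innerDr, innerZl, innerZr, innerNl, innerNr).
    rewrite (innerC y (K u)) !inner_norm -/p -/q -/s => h.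
    have {h} : 0 <= s * (q * s - p ^+ 2) by nra.
    have [s00 _|s_neq0] := eqVneq s 0.
      have y0 : y = 0 by apply/eqP; rewrite -normr_eq0 -sqrf_eq0 -/s s00.
      by rewrite /p y0 linear0r expr0n /= s00 mulr0.
    by rewrite pmulr_rge0 ?subr_ge0 // lt_neqAle eq_sym s_neq0.
  move=> /le_trans; apply.
  rewrite (@le_trans _ _ (c * `|u| * `|y|)) ?ler_wpM2r //.
  by rewrite mulrAC ler_wpM2r //; near: r; apply: nbhs_pinfty_ge; exact: num_real.
have [z fz] := riesz cf.
have : [set z | forall x, inner (K x) y = inner x z] (adjoint K y).
  by apply: (xgetPex 0); exists z => u; exact: fz.
exact.
Unshelve. all: by end_near. Qed.

End bounded_operators.

(* Only the topology of V matters here, so for V = H1 * H2 this is the weak   *)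
(* convergence of the Hilbert direct sum, although the library norm on the    *)
(* product is the maximum of the norms.                                       *)
Definition weakly_cvg (R : realType) (V : normedModType R) (u : nat -> V)
    (l : V) : Prop :=
  forall f : {linear V -> R^o}, continuous f -> f (u n) @[n --> \oo] --> f l.

Section set_valued_operators.
Variables (R : realType) (H : hilbertType R).
Implicit Types T : H -> set H.

Definition monotone_op T : Prop :=
  forall x y u v, T x u -> T y v -> 0 <= inner (x - y) (u - v).

Definition maximal_monotone T : Prop :=
  monotone_op T /\
  forall T', monotone_op T' -> (forall x, T x `<=` T' x) -> T' = T.

Definition inv_op T : H -> set H := fun u => [set x | T x u].

Definition scale_op (t : R) T : H -> set H := fun x => [set t *: u | u in T x].

(* J_T as a set-valued operator, so that y = J_T z is written resolvent T z y *)
Definition resolvent T : H -> set H :=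
  inv_op (fun x => [set x + u | u in T x]).

End set_valued_operators.

Section chambolle_pock.
Variables (R : realType) (H1 H2 : hilbertType R).
Variables (A1 : H1 -> set H1) (A2 : H2 -> set H2) (K : {linear H1 -> H2}).

Definition primal_solution (x : H1) : Prop :=
  [set u + adjoint K v | u in A1 x & v in A2 (K x)] 0.

Definition primal_dual_solution (x : H1) (y : H2) : Prop :=
  [set u + adjoint K y | u in A1 x] 0 /\
  [set - K x + v | v in inv_op A2 y] 0.

Definition sqnormM (tau theta : R) (x : H1) (y : H2) : R :=
  tau^-1 * `|x| ^+ 2 - 2 * inner (K x) y + theta^-1 * `|y| ^+ 2.

(* tx, ty, a hold the values accepted at the end of the inner loops; they are *)
(* indexed from 1, and their values at 0 are irrelevant.                      *)
Definition inexact_chambolle_pock (sigma tau theta : R) (x0 : H1) (y0 : H2)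
    (x : nat -> H1) (y : nat -> H2) (tx a : nat -> H1) (ty : nat -> H2) :
    Prop :=
  [/\ x 0%N = x0, y 0%N = y0 &
  forall k : nat,
   [/\ A1 (tx k.+1) (a k.+1),
       resolvent (scale_op theta (inv_op A2))
         (y k + theta *: K (tx k.+1 - tau *: (a k.+1 + adjoint K (y k))))
         (ty k.+1),
       tau^-1 *
         `|tau *: a k.+1 + tx k.+1 - (x k - tau *: adjoint K (y k))| ^+ 2
       <= sigma ^+ 2 * sqnormM tau theta (tx k.+1 - x k) (ty k.+1 - y k),
       x k.+1 = (x k - tau *: adjoint K (y k)) - tau *: a k.+1 &
       y k.+1 = ty k.+1]].

End chambolle_pock.

(* Main.v *)
From HB Require Import structures.
Require Import Defs.
From mathcomp Require Import all_boot all_order all_algebra.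
From mathcomp Require Import all_classical all_reals all_analysis.
From mathcomp Require Import ring lra.

(** The method is a hybrid proximal extragradient method for the primal-dual
    operator A (x, y) = (A1 x + K^* y, - K x + A2^-1 y) in the seminorm of M.
    Write u = (x, y) for the current iterate, u' for the next one and
    v = (tx, ty) for the accepted pair. The resolvent formula and the update say
    that M (u - u') belongs to A v, and the error criterion says that the
    seminorm of v - u' is at most sigma times that of v - u
    ([chambolle_pock_hybrid_step]). For every zero s of A, monotonicity then gives
    |u' - s|^2 + (1 - sigma^2) |v - u|^2 <= |u - s|^2 in the seminorm
    ([hybrid_step_fejer]). Hence |u - s| converges, |v - u| tends to 0, and so
    does the element M (u - u') of A v.

    The step size condition allows M to have a kernel, so the seminorm bounds
    neither the iterates nor their differences. What it does bound is M u
    ([precond1_le], [precond2_le]), and this suffices because M + A has a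
    Lipschitz inverse: the accepted pairs are bounded
    ([hybrid_step_primal_dist], [hybrid_step_dual_dist]), and two zeros of A that
    are identified by M coincide ([sqnormM_eq0_solutions]).

    Weak compactness is used along ultrafilters: along each of them a bounded
    sequence has a weak limit by compactness of segments and the Riesz theorem
    ([bounded_ultra_weak]). Every such limit of the accepted pairs is a zero of A
    ([demiclosed]), and Opial's argument shows that any two of them are
    identified by M ([ultra_limit_unique]). So the limit does not depend on the
    ultrafilter, and the whole sequence converges to it ([cvg_along_ultra]). *)

Set Implicit Arguments.
Unset Strict Implicit.
Unset Printing Implicit Defensive.

Import Order.TTheory GRing.Theory Num.Theory.
Import numFieldNormedType.Exports.

Local Open Scope classical_set_scope.
Local Open Scope ring_scope.

(** * Inner products and strong limits *)

Section inner_product.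
Variables (R : realType) (H : hilbertType R).
Implicit Types x y z : H.

Lemma innerBl z x y : inner (x - y) z = inner x z - inner y z.
Proof. by rewrite innerDl innerNl. Qed.

Lemma innerBr z x y : inner z (x - y) = inner z x - inner z y.
Proof. by rewrite innerDr innerNr. Qed.

Lemma inner0l z : inner 0 z = 0.
Proof. by rewrite -(subrr z) innerBl subrr. Qed.

Lemma cauchy_schwarz x y : `|inner x y| <= `|x| * `|y|.
Proof.
rewrite -(ler_pXn2r (n := 2)) ?nnegrE ?mulr_ge0 //.
rewrite exprMn real_normK ?num_real //.
set p := inner x y; set q := `|x| ^+ 2; set s := `|y| ^+ 2.
have [y0|yN0] := eqVneq s 0.
  have -> : p = 0.
    have /eqP : y == 0 by rewrite -normr_eq0 -sqrf_eq0 -/s y0.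
    by rewrite /p innerC => ->; rewrite inner0l.
  by rewrite expr0n y0 mulr0.
have s0 : 0 < s by rewrite lt_neqAle eq_sym yN0 exprn_ge0.
have := sqr_ge0 `|s *: x - p *: y|.
rewrite -inner_norm !(innerBl, innerBr, innerZl, innerZr) (innerC y x).
rewrite !inner_norm -/p -/q -/s => h.
rewrite -subr_ge0 -(pmulr_rge0 _ s0).
by apply: le_trans h _; rewrite le_eqVlt; apply/orP; left; apply/eqP; ring.
Qed.

Lemma inner_le0_eq0 x : inner x x <= 0 -> x = 0.
Proof.
rewrite inner_norm => x0; apply/eqP; rewrite -normr_eq0 -sqrf_eq0.
by rewrite eq_le x0 exprn_ge0.
Qed.

Lemma inner_inj x y : (forall h, inner h x = inner h y) -> x = y.
Proof.
move=> xy; apply/eqP; rewrite -subr_eq0; apply/eqP/inner_le0_eq0.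
by rewrite innerBr !xy subrr.
Qed.

(** This is how monotonicity yields Lipschitz bounds: a distance dominated by its
    inner product with a residual is dominated by the residual. *)
Lemma normr_le_inner x y : `|x| ^+ 2 <= inner x y -> `|x| <= `|y|.
Proof.
move=> xy; have [->|xN0] := eqVneq x 0; first by rewrite normr0.
rewrite -(ler_pM2l (_ : 0 < `|x|)) ?normr_gt0// -expr2 (le_trans xy)//.
exact: le_trans (ler_norm _) (cauchy_schwarz x y).
Qed.

Lemma inner_continuousl z : continuous (inner ^~ z : H -> R).
Proof.
move=> x; apply/cvgrPdist_le => e e0; near=> t.
rewrite -innerBl (le_trans (cauchy_schwarz _ _))//.
rewrite (@le_trans _ _ (`|x - t| * (`|z| + 1)))//.
  by rewrite ler_wpM2l// lerDl.
rewrite -ler_pdivlMr ?ltr_wpDl//; near: t.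
by apply: cvgr_dist_le => //; rewrite divr_gt0// ltr_wpDl.
Unshelve. all: by end_near. Qed.

Lemma cvg_inner_bounded (F : set_system nat) (FF : Filter F)
    (u v : nat -> H) (C : R) :
  (forall n, `|u n| <= C) -> v n @[n --> F] --> (0 : H) ->
  inner (u n) (v n) @[n --> F] --> (0 : R).
Proof.
move=> uC v0; apply/cvgr0Pnorm_le => e e0.
have C0 : 0 <= C := le_trans (normr_ge0 _) (uC 0%N).
near=> n; rewrite (le_trans (cauchy_schwarz _ _))//.
rewrite (@le_trans _ _ ((C + 1) * `|v n|))//.
  by rewrite ler_wpM2r// (le_trans (uC n))// lerDl.
rewrite mulrC -ler_pdivlMr ?ltr_wpDl//; near: n.
by apply: cvgr0_norm_le => //; rewrite divr_gt0// ltr_wpDl.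
Unshelve. all: by end_near. Qed.

End inner_product.

(** * Weak limits along ultrafilters *)

(** If f fails to converge to l, some neighbourhood of l is missed by f on a set
    B that meets every member of F; an ultrafilter finer than the trace of F on
    B then contradicts the hypothesis. *)
Lemma cvg_along_ultra (T : Type) (S : topologicalType) (F : set_system T)
    (FF : Filter F) (f : T -> S) (l : S) :
  (forall G, UltraFilter G -> F `<=` G -> f x @[x --> G] --> l) ->
  f x @[x --> F] --> l.
Proof.
move=> h N Nl; apply: contrapT => FN.
pose B := ~` (f @^-1` N).
have wP : ProperFilter (within B F).
  apply: Build_ProperFilter_ex => P FP.
  have {}FP : F [set x | B x -> P x] by [].
  apply: contrapT => /forallNP P0; apply: FN.
  apply: (filterS (P := [set x | B x -> P x])) FP => t BP.
  by apply: contrapT => NN; exact: (P0 t (BP NN)).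
have [G [GU wG]] := ultraFilterLemma wP.
have FG : F `<=` G.
  by move=> P FP; apply: wG; exact: (@cvg_within _ F FF B).
have GB : G B by apply: wG; exact: (@withinT _ F B FF).
have GN : G (f @^-1` N) := h G GU FG N Nl.
have [x [xB xN]] : (B `&` (f @^-1` N)) !=set0.
  by apply: (@filter_ex _ G); exact: filterI.
exact: xB.
Qed.

Lemma bounded_ultra_cvg (R : realType) (T : Type) (G : set_system T)
    (GU : UltraFilter G) (f : T -> R) (C : R) :
  (forall t, `|f t| <= C) -> exists l : R, f x @[x --> G] --> l.
Proof.
move=> fC.
have GfU : UltraFilter (f @ G).
  split; first exact: fmap_proper_filter.
  move=> G' G'P GG'; apply/seteqP; split => // A G'A.
  have [//|GnA] := in_ultra_setVsetC (f @^-1` A) GU.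
  have : G' (A `&` ~` A) by apply: filterI => //; exact: GG'.
  by rewrite setICr => /filter_not_empty.
have fGC : (f @ G) [set` `[- C, C]].
  by apply: (filterE (F := G)) => t; rewrite /= in_itv /= -ler_norml.
have := @segment_compact R (- C) C.
by rewrite compact_ultra => /(_ _ GfU fGC)[l [_ fl]]; exists l.
Qed.

(** Only existence of limits along ultrafilters is automatic for bounded
    sequences, so weak convergence is first studied along a filter G. *)
Definition ultra_weak (R : realType) (H : hilbertType R) (G : set_system nat)
  (u : nat -> H) (w : H) := forall h, inner (u n) h @[n --> G] --> inner w h.

(** Banach-Alaoglu for sequences: for each h the bounded real sequence of inner
    products with h has a limit along G, this limit is a bounded linear function
    of h, and Riesz represents it by a vector. No separability or diagonal
    extraction is involved. *)
Lemma bounded_ultra_weak (R : realType) (H : hilbertType R)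
    (G : set_system nat) (GU : UltraFilter G) (u : nat -> H) (C : R) :
  (forall n, `|u n| <= C) -> exists w, ultra_weak G u w.
Proof.
move=> uC.
have C0 : 0 <= C := le_trans (normr_ge0 _) (uC 0%N).
have uhC h n : `|inner (u n) h| <= C * `|h|.
  by rewrite (le_trans (cauchy_schwarz _ _))// ler_wpM2r.
have /choice[g gP] : forall h, exists l : R, inner (u n) h @[n --> G] --> l.
  by move=> h; exact: bounded_ultra_cvg (uhC h).
have glin : linear (g : H -> R^o).
  move=> c h k; apply: (@cvg_unique _ _ (inner (u n) (c *: h + k) @[n --> G])).
  - exact: norm_hausdorff.
  - exact: gP.
  have -> : (fun n => inner (u n) (c *: h + k)) =
            (fun n => c * inner (u n) h + inner (u n) k).
    by apply/funext => n; rewrite innerDr innerZr.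
  by apply: cvgD => //; apply: cvgMl_tmp.
pose Lg := GRing.isLinear.Build _ _ _ _ (g : H -> R^o) glin.
pose f : {linear H -> R^o} := HB.pack (g : H -> R^o) Lg.
have [|w wP] := @riesz _ _ f.
  apply/linear_bounded_continuous/linear_boundedP; near=> r => h.
  rewrite (@le_trans _ _ (C * `|h|))//; last first.
    by rewrite ler_wpM2r//; near: r; apply: nbhs_pinfty_ge; exact: num_real.
  apply: (cvgr_to_le (cvg_norm (gP h))).
  exact: filterS filterT.
by exists w => h; rewrite innerC -wP; exact: gP.
Unshelve. all: by end_near. Qed.

Lemma weakly_cvg_inner (R : realType) (H : hilbertType R)
    (u : nat -> H) (w : H) :
  (forall h, inner (u n) h @[n --> \oo] --> inner w h) -> weakly_cvg u w.
Proof.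
move=> uw f cf; have [z fz] := riesz cf.
by have -> : f = inner ^~ z :> (H -> R) by [apply/funext]; exact: uw.
Qed.

Lemma weakly_cvg_pair (R : realType) (V W : normedModType R)
    (u : nat -> V) (v : nat -> W) (p : V) (q : W) :
  weakly_cvg u p -> weakly_cvg v q ->
  weakly_cvg (V := (V * W)%type) (fun n => (u n, v n)) (p, q).
Proof.
move=> up vq f cf.
have f1lin : linear ((fun a => f (a, 0)) : V -> R^o).
  move=> c a b; rewrite -linearP; congr (f _).
  by apply: injective_projections; rewrite /= ?scaler0 ?addr0.
have f2lin : linear ((fun a => f (0, a)) : W -> R^o).
  move=> c a b; rewrite -linearP; congr (f _).
  by apply: injective_projections; rewrite /= ?scaler0 ?addr0.
pose L1 :=
  GRing.isLinear.Build _ _ _ _ ((fun a => f (a, 0)) : V -> R^o) f1lin.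
pose f1 : {linear V -> R^o} := HB.pack ((fun a => f (a, 0)) : V -> R^o) L1.
pose L2 :=
  GRing.isLinear.Build _ _ _ _ ((fun a => f (0, a)) : W -> R^o) f2lin.
pose f2 : {linear W -> R^o} := HB.pack ((fun a => f (0, a)) : W -> R^o) L2.
have fE a b : f (a, b) = f1 a + f2 b.
  rewrite /= -linearD; congr (f _).
  by apply: injective_projections; rewrite /= ?addr0 ?add0r.
under eq_fun do rewrite fE; rewrite fE; apply: cvgD.
  apply: up => a; apply: (@continuous_comp _ _ _ (fun a => (a, 0 : W)) f).
    by apply: cvg_pair => //; exact: cvg_cst.
  exact: cf.
apply: vq => a; apply: (@continuous_comp _ _ _ (fun a => (0 : V, a)) f).
  by apply: cvg_pair => //; exact: cvg_cst.
exact: cf.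
Qed.

(** * Maximal monotone operators *)

Section maximal_monotonicity.
Variable R : realType.

(** The graph of T enlarged by the point (x, u) is still monotone, so that by
    maximality it contains nothing new. *)
Lemma maximal_monotone_mem (H : hilbertType R) (T : H -> set H) (x u : H) :
  maximal_monotone T ->
  (forall z v, T z v -> 0 <= inner (x - z) (u - v)) -> T x u.
Proof.
move=> [mT maxT] h.
pose T' p := T p `|` [set q | p = x /\ q = u].
have -> : T = T'.
  apply/esym/maxT; last by move=> p q Tpq; left.
  move=> p p' q q' [Tpq|[-> ->]] [Tpq'|[-> ->]].
  - exact: mT.
  - by rewrite -(opprB x p) -(opprB u q) innerNl innerNr opprK; exact: h.
  - exact: h.
  - by rewrite subrr inner0l.
by right.
Qed.

(** Maximality of the product operator. If the first term were negative for some
    (z, p), the second would be bounded away from 0 from below; then (y, v) would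
    lie in the graph of T2 and could be chosen for (w, q), making the second term
    vanish. *)
Lemma maximal_monotone_mem_pair (H1 H2 : hilbertType R)
    (T1 : H1 -> set H1) (T2 : H2 -> set H2) (x u : H1) (y v : H2) :
  maximal_monotone T1 -> maximal_monotone T2 ->
  (forall z p w q, T1 z p -> T2 w q ->
     0 <= inner (x - z) (u - p) + inner (y - w) (v - q)) ->
  T1 x u /\ T2 y v.
Proof.
move=> mT1 mT2 h.
have T1xu : T1 x u.
  apply: maximal_monotone_mem => // z p Tzp; rewrite leNgt; apply/negP => neg.
  have T2yv : T2 y v.
    apply: maximal_monotone_mem => // w q Twq.
    by have := h z p w q Tzp Twq; lra.
  by have := h z p y v Tzp T2yv; rewrite (subrr y) inner0l; lra.
split => //; apply: maximal_monotone_mem => // w q Twq.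
by have := h x u w q T1xu Twq; rewrite subrr inner0l add0r.
Qed.

End maximal_monotonicity.

(** * Bounded operators and their adjoints *)

Section bounded_operator.
Variables (R : realType) (H1 H2 : hilbertType R) (K : {linear H1 -> H2}).
Hypothesis Kbnd : bounded_near K (nbhs (0 : H1)).

Lemma opnorm_ub z : `|z| <= 1 -> `|K z| <= opnorm K.
Proof.
have /linear_boundedP /pinfty_ex_gt0 [c c0 Kc] := Kbnd.
move=> z1; apply: sup_upper_bound; last by exists z.
split; first by exists `|K z|, z.
by exists c => _ [t /= t1 <-]; rewrite (le_trans (Kc t))// ler_piMr// ltW.
Qed.

Lemma opnorm_ge0 : 0 <= opnorm K.
Proof. by rewrite (le_trans (normr_ge0 (K 0)))// opnorm_ub// normr0. Qed.

Lemma opnorm_le x : `|K x| <= opnorm K * `|x|.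
Proof.
have [->|xN0] := eqVneq x 0; first by rewrite linear0 !normr0 mulr0.
have x0 : 0 < `|x| by rewrite normr_gt0.
have := @opnorm_ub (`|x|^-1 *: x); rewrite linearZ !normrZ normfV normr_id.
by rewrite mulVf ?normr_eq0// lexx mulrC ler_pdivrMr// => /(_ isT).
Qed.

Lemma adjoint_opnorm_le y : `|adjoint K y| <= opnorm K * `|y|.
Proof.
have [->|yN0] := eqVneq (adjoint K y) 0.
  by rewrite normr0 mulr_ge0// opnorm_ge0.
rewrite -(ler_pM2l (_ : 0 < `|adjoint K y|)) ?normr_gt0//.
rewrite -expr2 -inner_norm -(adjointP Kbnd).
rewrite (le_trans (ler_norm _))// (le_trans (cauchy_schwarz _ _))//.
by rewrite mulrA ler_wpM2r// mulrC opnorm_le.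
Qed.

Lemma adjointB y y' : adjoint K (y - y') = adjoint K y - adjoint K y'.
Proof.
by apply: inner_inj => h; rewrite innerBr -!(adjointP Kbnd) innerBr.
Qed.

Lemma inner_adjointl y x : inner (adjoint K y) x = inner (K x) y.
Proof. by rewrite innerC (adjointP Kbnd). Qed.

End bounded_operator.

(** * The preconditioner M and its seminorm *)

Section preconditioner.
Variables (R : realType) (H1 H2 : hilbertType R) (K : {linear H1 -> H2}).
Variables (tau theta : R).
Implicit Types (x tx xs : H1) (y ty ys : H2).
Hypothesis Kbnd : bounded_near K (nbhs (0 : H1)).
Hypothesis tau_gt0 : 0 < tau.
Hypothesis theta_gt0 : 0 < theta.

(** [precond1] and [precond2] are the two components of M (x, y). *)
Definition precond1 (x : H1) (y : H2) : H1 := tau^-1 *: x - adjoint K y.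

Definition precond2 (x : H1) (y : H2) : H2 := theta^-1 *: y - K x.

Lemma precond1B x y x' y' :
  precond1 (x - x') (y - y') = precond1 x y - precond1 x' y'.
Proof.
rewrite /precond1 adjointB// scalerBr !opprB addrACA [RHS]addrACA.
by congr (_ + _); exact: addrC.
Qed.

Lemma precond2B x y x' y' :
  precond2 (x - x') (y - y') = precond2 x y - precond2 x' y'.
Proof.
rewrite /precond2 (linearB K) scalerBr !opprB addrACA [RHS]addrACA.
by congr (_ + _); exact: addrC.
Qed.

(** The quadratic form of M is the seminorm of the method. *)
Lemma inner_precond x y : inner (precond1 x y) x + inner (precond2 x y) y
  = sqnormM K tau theta x y.
Proof.
rewrite /sqnormM /precond1 /precond2 !innerBl !innerZl inner_adjointl//.
by rewrite !inner_norm; ring.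
Qed.

Hypothesis step_le1 : tau * theta * opnorm K ^+ 2 <= 1.

(** Since M is positive semidefinite, the norm of M u is controlled by the
    seminorm of u, even where the seminorm degenerates. Completing the square in
    x leaves the term in y, nonnegative by the step size condition. *)
Lemma precond1_le x y : tau * `|precond1 x y| ^+ 2 <= sqnormM K tau theta x y.
Proof.
have xz : inner x (adjoint K y) = inner (K x) y by rewrite (adjointP Kbnd).
rewrite /precond1 /sqnormM; move: (adjoint_opnorm_le Kbnd y) xz.
move: (adjoint K y) => z zy xz.
have {}zy : tau * `|z| ^+ 2 <= theta^-1 * `|y| ^+ 2.
  rewrite mulrC ler_pdivlMl//.
  move: zy; rewrite -(ler_pXn2r (n := 2)) ?nnegrE ?mulr_ge0 ?opnorm_ge0//.
  rewrite exprMn => zy.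
  have := ler_wpM2r (sqr_ge0 `|y|) step_le1; rewrite mul1r; apply: le_trans.
  rewrite [leRHS](_ : _ = theta * tau * (opnorm K ^+ 2 * `|y| ^+ 2)); last first.
    by ring.
  by rewrite mulrCA mulrC ler_wpM2l// mulr_ge0// ltW.
rewrite -[`|tau^-1 *: x - z| ^+ 2]inner_norm !(innerBl, innerBr).
rewrite !(innerZl, innerZr) (innerC z x) xz !inner_norm.
rewrite -subr_ge0; move: zy; rewrite -subr_ge0 => zy.
apply: etrans zy; congr (0 <= _).
by field; rewrite !gt_eqF.
Qed.

Lemma precond2_le x y : theta * `|precond2 x y| ^+ 2 <= sqnormM K tau theta x y.
Proof.
have Kx : theta * `|K x| ^+ 2 <= tau^-1 * `|x| ^+ 2.
  rewrite mulrC ler_pdivlMl//.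
  have := opnorm_le Kbnd x.
  rewrite -(ler_pXn2r (n := 2)) ?nnegrE ?mulr_ge0 ?opnorm_ge0//.
  rewrite exprMn => Kx.
  have := ler_wpM2r (sqr_ge0 `|x|) step_le1; rewrite mul1r; apply: le_trans.
  rewrite [leRHS](_ : _ = tau * theta * (opnorm K ^+ 2 * `|x| ^+ 2)); last first.
    by ring.
  by rewrite mulrCA mulrC ler_wpM2l// mulr_ge0// ltW.
rewrite -[`|precond2 x y| ^+ 2]inner_norm /precond2 /sqnormM.
rewrite !(innerBl, innerBr) !(innerZl, innerZr) (innerC y) !inner_norm.
rewrite -subr_ge0; move: Kx; rewrite -subr_ge0 => Kx.
apply: etrans Kx; congr (0 <= _).
by field; rewrite !gt_eqF.
Qed.

Lemma sqnormM_ge0 x y : 0 <= sqnormM K tau theta x y.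
Proof. apply: le_trans (precond1_le x y).
by apply: mulr_ge0; [exact: ltW|exact: exprn_ge0]. Qed.

Lemma sqnormM_triangle x y x' y' : sqnormM K tau theta (x - x') (y - y') <=
  2 * sqnormM K tau theta x y + 2 * sqnormM K tau theta x' y'.
Proof.
have := sqnormM_ge0 (x + x') (y + y').
rewrite /sqnormM -!inner_norm (linearD K) (linearB K).
rewrite !(innerDl, innerDr, innerNl, innerNr).
by rewrite (innerC x' x) (innerC y' y); nra.
Qed.

(** The polarization identity for M, which bounds the decrease of the distance to
    (xs, ys) when M (u - u') is monotonically related to the residual point
    (tx, ty). *)
Lemma sqnormM_descent x y x' y' tx ty xs ys :
  0 <= inner (precond1 (x - x') (y - y')) (tx - xs) +
       inner (precond2 (x - x') (y - y')) (ty - ys) ->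
  sqnormM K tau theta (x' - xs) (y' - ys) +
  sqnormM K tau theta (tx - x) (ty - y) <=
  sqnormM K tau theta (x - xs) (y - ys) +
  sqnormM K tau theta (tx - x') (ty - y').
Proof.
move=> h; rewrite -subr_ge0 (_ : _ - _ =
  2 * (inner (precond1 (x - x') (y - y')) (tx - xs) +
       inner (precond2 (x - x') (y - y')) (ty - ys))).
  by rewrite mulr_ge0.
rewrite /precond1 /precond2 /sqnormM -!inner_norm !(linearB K).
rewrite !(innerDl, innerNl, innerZl, inner_adjointl Kbnd) !(linearB K).
rewrite !(innerDl, innerNl, innerDr, innerNr).
rewrite (innerC tx x') (innerC xs x') (innerC tx x) (innerC xs x).
rewrite (innerC ty y') (innerC ys y') (innerC ty y) (innerC ys y).
ring.
Qed.

(** The seminorm may vanish on nonzero vectors, but not on the difference of two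
    solutions: M u = M u' turns monotonicity of A1 into
    - tau^-1 |x - x'|^2 >= 0, and y = y' follows from the second component. *)
Lemma sqnormM_eq0_solutions (A1 : H1 -> set H1) (A2 : H2 -> set H2)
    (x x' : H1) (y y' : H2) :
  monotone_op A1 -> monotone_op A2 ->
  A1 x (- adjoint K y) -> A2 (K x) y ->
  A1 x' (- adjoint K y') -> A2 (K x') y' ->
  sqnormM K tau theta (x - x') (y - y') = 0 ->
  x = x' /\ y = y'.
Proof.
move=> mA1 mA2 A1x A2x A1x' A2x' N0.
have P1 : precond1 (x - x') (y - y') = 0.
  apply: inner_le0_eq0; rewrite inner_norm -(pmulr_rle0 _ tau_gt0) -N0.
  exact: precond1_le.
have P2 : precond2 (x - x') (y - y') = 0.
  apply: inner_le0_eq0; rewrite inner_norm -(pmulr_rle0 _ theta_gt0) -N0.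
  exact: precond2_le.
have xx' : x = x'.
  apply/eqP; rewrite -subr_eq0; apply/eqP/inner_le0_eq0.
  have := mA1 _ _ _ _ A1x A1x'; rewrite -opprD -(adjointB Kbnd).
  move/eqP: P1; rewrite /precond1 subr_eq0 => /eqP <-.
  by rewrite innerNr innerZr oppr_ge0 pmulr_rle0// invr_gt0.
split => //; move/eqP: P2; rewrite xx' /precond2 subrr linear0 subr0.
by rewrite scaler_eq0 invr_eq0 gt_eqF//= subr_eq0 => /eqP.
Qed.

(** Weak-strong closedness of the primal-dual operator. In the monotonicity
    inequality of the product of A1 and the inverse of A2, the products of two
    weakly convergent sequences come from the skew part (x, y) |-> (K^* y, - K x)
    only and cancel, so the inequality passes to the limit; maximality of the
    product then gives the inclusions at the limit, without a sum theorem. *)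
Lemma demiclosed (A1 : H1 -> set H1) (A2 : H2 -> set H2)
    (G : set_system nat) (GP : ProperFilter G)
    (tx a : nat -> H1) (ty b : nat -> H2) (C : R) (w1 : H1) (w2 : H2) :
  maximal_monotone A1 -> maximal_monotone A2 ->
  (forall n, A1 (tx n) (a n)) -> (forall n, A2 (b n) (ty n)) ->
  (forall n, `|tx n| <= C) -> (forall n, `|ty n| <= C) ->
  ultra_weak G tx w1 -> ultra_weak G ty w2 ->
  a n + adjoint K (ty n) @[n --> G] --> (0 : H1) ->
  b n - K (tx n) @[n --> G] --> (0 : H2) ->
  A1 w1 (- adjoint K w2) /\ A2 (K w1) w2.
Proof.
move=> mA1 mA2 Aa Ab Cx Cy wx wy p0 q0.
apply: maximal_monotone_mem_pair => // z p w q Tzp Twq.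
have lim : inner (tx n) (a n + adjoint K (ty n)) - inner (tx n) p
   - inner (a n + adjoint K (ty n)) z + inner (ty n) (K z) + inner z p
   + inner (ty n) (b n - K (tx n)) - inner (b n - K (tx n)) q
   - inner (tx n) (adjoint K q) - inner (ty n) w + inner w q @[n --> G] -->
   0 - inner w1 p - 0 + inner w2 (K z) + inner z p + 0 - 0
   - inner w1 (adjoint K q) - inner w2 w + inner w q.
  apply: cvgD; last exact: cvg_cst.
  apply: cvgB; last exact: wy.
  apply: cvgB; last exact: wx.
  apply: cvgB; last first.
    by rewrite -(inner0l q); exact: cvg_comp q0 (@inner_continuousl _ _ q 0).
  apply: cvgD; last exact: cvg_inner_bounded Cy q0.
  apply: cvgD; last exact: cvg_cst.
  apply: cvgD; last exact: wy.
  apply: cvgB; last first.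
    by rewrite -(inner0l z); exact: cvg_comp p0 (@inner_continuousl _ _ z 0).
  by apply: cvgB; [exact: cvg_inner_bounded Cx p0|exact: wx].
rewrite (_ : _ + _ = 0 - inner w1 p - 0 + inner w2 (K z) + inner z p + 0 - 0
   - inner w1 (adjoint K q) - inner w2 w + inner w q).
  apply: (cvgr_to_ge lim); apply: filterE => n.
  apply: etrans (addr_ge0 (mA1.1 _ _ _ _ (Aa n) Tzp)
                          (mA2.1 _ _ _ _ (Ab n) Twq)).
  congr (0 <= _).
  rewrite !(innerBl, innerDl, innerDr, innerNr).
  rewrite -!(adjointP Kbnd) !inner_adjointl// (innerC z (a n)).
  rewrite (innerC (ty n) (K z)) (innerC (ty n) (b n)) (innerC (ty n) (K (tx n))).
  rewrite (innerC (ty n) w).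
  ring.
rewrite !(innerBl, innerBr, innerDl, innerDr, innerNr) -!(adjointP Kbnd).
rewrite (innerC w2 (K z)) (innerC w2 w); ring.
Qed.

End preconditioner.

(** * One step of the method *)

Section hybrid_step.
Variables (R : realType) (H1 H2 : hilbertType R) (K : {linear H1 -> H2}).
Variables (A1 : H1 -> set H1) (A2 : H2 -> set H2).
Variables (sigma tau theta : R).
Hypothesis Kbnd : bounded_near K (nbhs (0 : H1)).
Hypothesis tau_gt0 : 0 < tau.
Hypothesis theta_gt0 : 0 < theta.
Hypothesis mA1 : maximal_monotone A1.
Hypothesis mA2 : maximal_monotone A2.

Local Notation N := (sqnormM K tau theta).
Local Notation P1 := (precond1 K tau).
Local Notation P2 := (precond2 K theta).

(** The primal-dual inclusions, solved for the points of the graphs of A1 and A2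
    to which monotonicity is applied. *)
Definition saddle (xs : H1) (ys : H2) := A1 xs (- adjoint K ys) /\ A2 (K xs) ys.

Lemma saddle_dual_solution xs ys :
  saddle xs ys -> primal_dual_solution A1 A2 K xs ys.
Proof.
move=> [A1xs A2xs]; split.
  by exists (- adjoint K ys) => //; rewrite addNr.
by exists (K xs) => //; rewrite addNr.
Qed.

Lemma saddle_primal_solution xs ys :
  saddle xs ys -> primal_solution A1 A2 K xs.
Proof.
move=> [A1xs A2xs]; exists (- adjoint K ys) => //.
by exists ys => //; rewrite addNr.
Qed.

Lemma primal_solution_saddle xs :
  primal_solution A1 A2 K xs -> exists ys, saddle xs ys.
Proof.
move=> [u A1xs [v A2xs /eqP]]; rewrite addr_eq0 => /eqP uE.
by exists v; split => //; rewrite -uE.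
Qed.

(** A step of the hybrid proximal extragradient method for the metric M and the
    primal-dual operator: M (u - u') belongs to the operator at (tx, ty), and the
    seminorm of (tx, ty) - u' is at most sigma times that of (tx, ty) - u, where
    u = (x, y) and u' = (x', ty). The two points share the dual component, which
    is why the left member of the criterion involves tx - x' only. *)
Definition hybrid_step (x : H1) (y : H2) (tx a : H1) (ty b : H2) (x' : H1) :=
  [/\ A1 tx a, A2 b ty, a + adjoint K ty = P1 (x - x') (y - ty),
      b - K tx = P2 (x - x') (y - ty) &
      tau^-1 * `|tx - x'| ^+ 2 <= sigma ^+ 2 * N (tx - x) (ty - y)].

(** The element b of the inverse of A2 at ty is read off the resolvent equation,
    and the primal update says that the vector in the criterion is tx - x'. *)
Lemma chambolle_pock_hybrid_step x y tx a ty x' :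
  A1 tx a ->
  resolvent (scale_op theta (inv_op A2))
    (y + theta *: K (tx - tau *: (a + adjoint K y))) ty ->
  tau^-1 * `|tau *: a + tx - (x - tau *: adjoint K y)| ^+ 2 <=
    sigma ^+ 2 * N (tx - x) (ty - y) ->
  x' = (x - tau *: adjoint K y) - tau *: a ->
  exists b, hybrid_step x y tx a ty b x'.
Proof.
move=> A1tx [_ [b A2b <-] /= bE] err x'E; exists b.
have aE : tau *: a = x - x' - tau *: adjoint K y.
  by rewrite x'E addrAC subKr.
have tauK (v : H1) : tau^-1 *: (tau *: v) = v.
  by rewrite scalerA mulVf ?scale1r// gt_eqF.
split => //.
- rewrite /precond1 adjointB// -[a in LHS]tauK aE scalerBr tauK.
  by rewrite opprB addrA addrAC.
- have -> : b = theta^-1 *: (theta *: b).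
    by rewrite scalerA mulVf ?scale1r// gt_eqF.
  have -> : theta *: b =
    (y - ty) + theta *: K (tx - tau *: (a + adjoint K y)).
    by apply: (addrI ty); rewrite bE addrA [ty + (y - ty)]addrC subrK.
  rewrite scalerDr scalerA mulVf ?gt_eqF// scale1r /precond2 -addrA.
  congr (_ + _).
  rewrite scalerDr aE subrK -(linearB K) -(linearN K); congr (K _).
  by rewrite addrAC subrr add0r.
- rewrite x'E; apply: etrans err; congr (_ * `|_| ^+ 2 <= _).
  by rewrite opprB addrA [tx + _]addrC.
Qed.

Section one_step.
Variables (x : H1) (y : H2) (tx a : H1) (ty b : H2) (x' : H1).
Variables (xs : H1) (ys : H2).
Hypothesis stepP : hybrid_step x y tx a ty b x'.
Hypothesis sadP : saddle xs ys.

Lemma hybrid_step_fejer :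
  N (x' - xs) (ty - ys) + (1 - sigma ^+ 2) * N (tx - x) (ty - y) <=
  N (x - xs) (y - ys).
Proof.
have [A1tx A2ty aE bE err] := stepP; have [A1xs A2xs] := sadP.
have mono : 0 <= inner (P1 (x - x') (y - ty)) (tx - xs) +
                 inner (P2 (x - x') (y - ty)) (ty - ys).
  (* The contributions of the skew part cancel. *)
  have := addr_ge0 (mA1.1 _ _ _ _ A1tx A1xs) (mA2.1 _ _ _ _ A2ty A2xs).
  rewrite -aE -bE => mono; apply: etrans mono; congr (0 <= _).
  rewrite !(innerBl, innerDl, innerBr, innerDr, innerNr) -!(adjointP Kbnd).
  rewrite !inner_adjointl// (innerC tx a) (innerC xs a).
  ring.
have := sqnormM_descent Kbnd mono.
rewrite (_ : N (tx - x') (ty - ty) = tau^-1 * `|tx - x'| ^+ 2); last first.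
  by rewrite /sqnormM subrr (innerC _ 0) inner0l normr0; ring.
by move: err; lra.
Qed.

(** Lipschitz continuity of the first row of (M + A)^-1, where the dual variable
    cancels. It bounds tx even when the seminorm of u - (xs, ys) does not bound
    x - xs. *)
Lemma hybrid_step_primal_dist :
  `|tx - xs| <= `|tau *: P1 (x - xs) (y - ys) + (tx - x')|.
Proof.
have [A1tx _ aE _ _] := stepP; have [A1xs _] := sadP.
apply: normr_le_inner; rewrite -inner_norm.
have := mA1.1 _ _ _ _ A1tx A1xs.
rewrite opprK -(addrK (adjoint K ty) a) aE -(pmulr_rge0 _ tau_gt0) => mono.
rewrite -subr_ge0; apply: etrans mono; congr (0 <= _).
rewrite /precond1 !(innerDr, innerNr, innerZr) -!(adjointP Kbnd).
rewrite !(linearB K) !(innerDr, innerNr, innerDl, innerNl).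
by rewrite (innerC xs tx); field; rewrite gt_eqF.
Qed.

(** The second row of (M + A)^-1: the primal variable enters only through K. *)
Lemma hybrid_step_dual_dist :
  `|ty - ys| <= `|theta *: (P2 (x - xs) (y - ys)
                   + K (2 *: (tx - xs) - (tx - x')))|.
Proof.
have [_ A2ty _ bE _] := stepP; have [_ A2xs] := sadP.
apply: normr_le_inner; rewrite -inner_norm.
have := mA2.1 _ _ _ _ A2ty A2xs.
rewrite -(subrK (K tx) b) bE -(pmulr_rge0 _ theta_gt0) innerC => mono.
rewrite -subr_ge0; apply: etrans mono; congr (0 <= _).
rewrite /precond2 !(linearB K) (linearZZ K) !(linearB K).
rewrite !(innerDr, innerNr, innerZr) !(innerDr, innerNr, innerDl, innerNl).
by rewrite (innerC ys ty); field; rewrite gt_eqF.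
Qed.

End one_step.

End hybrid_step.

(** * Convergence of the iterates *)

Lemma cvg0_sqr (R : realType) (V : normedModType R) (v : nat -> V)
    (c : R) (r : nat -> R) :
  0 < c -> (forall n, c * `|v n| ^+ 2 <= r n) ->
  r n @[n --> \oo] --> (0 : R) -> v n @[n --> \oo] --> (0 : V).
Proof.
move=> c0 vr r0; apply/cvgr0Pnorm_le => e e0; near=> n.
have rn : `|r n| <= c * e ^+ 2.
  by near: n; apply: cvgr0_norm_le => //; rewrite mulr_gt0// exprn_gt0.
rewrite -(ler_pXn2r (n := 2)) ?nnegrE ?(ltW e0)//.
rewrite -(ler_pM2l c0) (le_trans (vr n))//.
exact: le_trans (ler_norm _) rn.
Unshelve. all: by end_near. Qed.

Section hybrid_sequence.
Variables (R : realType) (H1 H2 : hilbertType R) (K : {linear H1 -> H2}).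
Variables (A1 : H1 -> set H1) (A2 : H2 -> set H2).
Variables (sigma tau theta : R).
Hypothesis Kbnd : bounded_near K (nbhs (0 : H1)).
Hypothesis tau_gt0 : 0 < tau.
Hypothesis theta_gt0 : 0 < theta.
Hypothesis step_le1 : tau * theta * opnorm K ^+ 2 <= 1.
Hypothesis sigma01 : 0 <= sigma < 1.
Hypothesis mA1 : maximal_monotone A1.
Hypothesis mA2 : maximal_monotone A2.
Variables (x tx a : nat -> H1) (y b : nat -> H2).
Hypothesis stepP : forall k, hybrid_step K A1 A2 sigma tau theta
  (x k) (y k) (tx k) (a k) (y k.+1) (b k) (x k.+1).
Variables (xs : H1) (ys : H2).
Hypothesis sadP : saddle K A1 A2 xs ys.

Local Notation N := (sqnormM K tau theta).
Local Notation P1 := (precond1 K tau).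
Local Notation P2 := (precond2 K theta).
Local Notation gap k := (N (tx k - x k) (y k.+1 - y k)).

Let N_ge0 := sqnormM_ge0 Kbnd tau_gt0 theta_gt0 step_le1.

Let sigma2 : 0 < 1 - sigma ^+ 2.
Proof. by have /andP[s0 s1] := sigma01; rewrite subr_gt0 expr_lt1. Qed.

Lemma fejer_nonincreasing (p : H1) (q : H2) : saddle K A1 A2 p q ->
  nonincreasing_seq (fun k => N (x k - p) (y k - q)).
Proof.
move=> pq; apply/nonincreasing_seqP => k.
have := hybrid_step_fejer Kbnd mA1 mA2 (stepP k) pq.
by apply: le_trans; rewrite lerDl mulr_ge0// ltW.
Qed.

Lemma fejer_cvg (p : H1) (q : H2) : saddle K A1 A2 p q ->
  cvgn (fun k => N (x k - p) (y k - q)).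
Proof.
move=> /fejer_nonincreasing /nonincreasing_is_cvgn; apply.
by exists 0 => _ [k _ <-].
Qed.

(** Up to the factor 1 - sigma^2, the gap is at most the difference of two
    consecutive terms of a convergent sequence. *)
Lemma gap_cvg0 : gap k @[k --> \oo] --> (0 : R).
Proof.
pose s k := N (x k - xs) (y k - ys).
have /cvg_ex[l sl] : cvgn s := fejer_cvg sadP.
have lim : (1 - sigma ^+ 2)^-1 * (s k - s k.+1) @[k --> \oo] --> (0 : R).
  rewrite -(mulr0 (1 - sigma ^+ 2)^-1) -(subrr l).
  by apply: cvgMl_tmp; apply: cvgB => //; rewrite (cvg_shiftS s).
apply: (squeeze_cvgr _ (cvg_cst 0) lim); apply: nearW => k.
rewrite N_ge0/= mulrC ler_pdivlMr// mulrC.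
by have := hybrid_step_fejer Kbnd mA1 mA2 (stepP k) sadP; rewrite /s; lra.
Qed.

Lemma correction_le_gap k : tau^-1 * `|tx k - x k.+1| ^+ 2 <= gap k.
Proof.
have [_ _ _ _ err] := stepP k; apply: le_trans err _.
by rewrite ler_piMl// -subr_ge0 ltW.
Qed.

Lemma increment_le_gap k : N (x k - x k.+1) (y k - y k.+1) <= 4 * gap k.
Proof.
have := sqnormM_triangle Kbnd tau_gt0 theta_gt0 step_le1
  (tx k - x k.+1) (y k.+1 - y k.+1) (tx k - x k) (y k.+1 - y k).
rewrite (_ : tx k - x k.+1 - _ = x k - x k.+1); last first.
  by rewrite opprB addrC addrA subrK.
rewrite (_ : y k.+1 - y k.+1 - _ = y k - y k.+1); last first.
  by rewrite subrr sub0r opprB.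
rewrite {2}/sqnormM subrr (innerC _ 0) inner0l normr0.
by have := correction_le_gap k; lra.
Qed.

Lemma residual_cvg0 :
  a k + adjoint K (y k.+1) @[k --> \oo] --> (0 : H1) /\
  b k - K (tx k) @[k --> \oo] --> (0 : H2).
Proof.
have lim : 4 * gap k @[k --> \oo] --> (0 : R).
  by rewrite -(mulr0 4); apply: cvgMl_tmp; exact: gap_cvg0.
split.
  apply: (cvg0_sqr tau_gt0) lim => k; have [_ _ -> _ _] := stepP k.
  apply: le_trans (increment_le_gap k).
  exact: precond1_le.
apply: (cvg0_sqr theta_gt0) lim => k; have [_ _ _ -> _] := stepP k.
apply: le_trans (increment_le_gap k).
exact: precond2_le.
Qed.

(** Only the seminorm of u - (xs, ys) is bounded by its initial value; the two
    Lipschitz estimates transfer the bound to the accepted pairs. *)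
Lemma hybrid_bounded :
  exists C : R, (forall k, `|tx k| <= C) /\ (forall k, `|y k.+1| <= C).
Proof.
pose s0 := N (x 0%N - xs) (y 0%N - ys).
have ss0 k : N (x k - xs) (y k - ys) <= s0.
  by have := fejer_nonincreasing sadP (leq0n k).
(* From t ^ 2 <= B one gets t <= B + 1, which avoids square roots. *)
have le_sqr (V : normedModType R) (v : V) (c B : R) :
    0 < c -> c * `|v| ^+ 2 <= B -> `|v| <= c^-1 * B + 1.
  move=> c0 vB.
  have : `|v| ^+ 2 <= c^-1 * B by rewrite mulrC ler_pdivlMr// mulrC.
  by have := sqr_ge0 (`|v| - 1); have := sqr_ge0 `|v|; nra.
have P1b k : `|P1 (x k - xs) (y k - ys)| <= tau^-1 * s0 + 1.
  apply: le_sqr => //; apply: le_trans (ss0 k).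
  exact: precond1_le.
have P2b k : `|P2 (x k - xs) (y k - ys)| <= theta^-1 * s0 + 1.
  apply: le_sqr => //; apply: le_trans (ss0 k).
  exact: precond2_le.
have corr k : `|tx k - x k.+1| <= tau^-1^-1 * (s0 / (1 - sigma ^+ 2)) + 1.
  apply: le_sqr; first by rewrite invr_gt0.
  apply: le_trans (correction_le_gap k) _.
  rewrite ler_pdivlMr//; have := hybrid_step_fejer Kbnd mA1 mA2 (stepP k) sadP.
  by have := N_ge0 (x k.+1 - xs) (y k.+1 - ys); have := ss0 k; lra.
move: (tau^-1 * s0 + 1) (theta^-1 * s0 + 1) (_ * (s0 / _) + 1) P1b P2b corr.
move=> C1 C2 C3 P1b P2b corr.
pose D := tau * C1 + C3.
have txb k : `|tx k - xs| <= D.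
  rewrite (le_trans (hybrid_step_primal_dist Kbnd tau_gt0 mA1 (stepP k) sadP))//.
  rewrite (le_trans (ler_normD _ _))// lerD// normrZ gtr0_norm//.
  by rewrite ler_pM2l.
pose E := theta * (C2 + opnorm K * (2 * D + C3)).
have yb k : `|y k.+1 - ys| <= E.
  rewrite (le_trans (hybrid_step_dual_dist theta_gt0 mA2 (stepP k) sadP))//.
  rewrite normrZ gtr0_norm// ler_pM2l// (le_trans (ler_normD _ _))// lerD//.
  rewrite (le_trans (opnorm_le Kbnd _))// ler_wpM2l ?opnorm_ge0//.
  rewrite (le_trans (ler_normB _ _))// lerD// normrZ ger0_norm//.
  by rewrite ler_pM2l.
exists (Num.max (D + `|xs|) (E + `|ys|)); split => k; rewrite le_max.
  by rewrite -{1}(subrK xs (tx k)) (le_trans (ler_normD _ _))// lerD2r.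
rewrite -[X in _ || (`|X| <= _)](subrK ys (y k.+1)).
by rewrite (le_trans (ler_normD _ _)) ?orbT// lerD2r.
Qed.

(** Opial's argument in the seminorm. By polarization the inner products of
    (tx k, y k.+1) with M (w - w', z - z') converge; computing their limit along
    G and along G' gives two equal values, whose difference is the squared
    seminorm of (w - w', z - z'). *)
Lemma ultra_limit_unique (G G' : set_system nat) (w w' : H1) (z z' : H2) :
  ProperFilter G -> ProperFilter G' -> \oo `<=` G -> \oo `<=` G' ->
  saddle K A1 A2 w z -> saddle K A1 A2 w' z' ->
  ultra_weak G tx w -> ultra_weak G (fun k => y k.+1) z ->
  ultra_weak G' tx w' -> ultra_weak G' (fun k => y k.+1) z' ->
  w = w' /\ z = z'.
Proof.
move=> GP GP' oG oG' sw sw' txw yz txw' yz'.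
apply: (sqnormM_eq0_solutions Kbnd tau_gt0 theta_gt0 step_le1 mA1.1 mA2.1
  sw.1 sw.2 sw'.1 sw'.2).
pose d1 := P1 (w - w') (z - z'); pose d2 := P2 (w - w') (z - z').
pose g k := inner (tx k) d1 + inner (y k.+1) d2.
have /cvg_ex[c gc] : cvgn g.
  have /cvg_ex[l lw] := fejer_cvg sw; have /cvg_ex[l' lw'] := fejer_cvg sw'.
  (* Polarization, with the iterate x k, y k replaced by tx k, y k.+1; the last
     two terms account for the replacement and tend to 0. *)
  have gE : g = fun k =>
      2^-1 * (N w z - N w' z' - N (x k - w) (y k - z) + N (x k - w') (y k - z'))
      + (inner (P1 (tx k - x k) (y k.+1 - y k)) (w - w')
        + inner (P2 (tx k - x k) (y k.+1 - y k)) (z - z')).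
    apply/funext => k; rewrite /g /d1 /d2 /precond1 /precond2 /sqnormM.
    rewrite -!inner_norm !(linearB K) !(innerBl, innerBr, innerZl, innerZr).
    rewrite !inner_adjointl// !adjointB// !innerBr -!(adjointP Kbnd).
    rewrite (innerC w (x k)) (innerC w' (x k)).
    rewrite (innerC z (y k)) (innerC z' (y k)).
    rewrite (innerC _ (K w)) (innerC _ (K w')).
    by field; rewrite !gt_eqF.
  have e1 : P1 (tx k - x k) (y k.+1 - y k) @[k --> \oo] --> (0 : H1).
    by apply: (cvg0_sqr tau_gt0) gap_cvg0 => k; exact: precond1_le.
  have e2 : P2 (tx k - x k) (y k.+1 - y k) @[k --> \oo] --> (0 : H2).
    by apply: (cvg0_sqr theta_gt0) gap_cvg0 => k; exact: precond2_le.
  rewrite gE; apply/cvg_ex; eexists; apply: cvgD.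
    apply: cvgMl_tmp; apply: cvgD; last exact: lw'.
    by apply: cvgB; [exact: cvg_cst|exact: lw].
  by apply: cvgD; [exact: cvg_comp e1 (@inner_continuousl _ _ (w - w') 0)
                  |exact: cvg_comp e2 (@inner_continuousl _ _ (z - z') 0)].
have lim (F : set_system nat) (v : H1) (t : H2) : ProperFilter F -> \oo `<=` F ->
    ultra_weak F tx v -> ultra_weak F (fun k => y k.+1) t ->
    inner v d1 + inner t d2 = c.
  move=> FP oF txv yt; apply: (@cvg_unique _ _ (g k @[k --> F])).
  - exact: norm_hausdorff.
  - by apply: cvgD; [exact: txv|exact: yt].
  - by move=> B cB; apply: oF; exact: gc.
rewrite -(inner_precond _ _ Kbnd) -/d1 -/d2 (innerC d1) (innerC d2) !innerBl.
have := lim G w z GP oG txw yz; have := lim G' w' z' GP' oG' txw' yz'; lra.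
Qed.

(** The limit is read off one ultrafilter; all others give the same one. *)
Lemma hybrid_weak_cvg : exists (p : H1) (q : H2),
  [/\ weakly_cvg tx p, weakly_cvg (fun k => y k.+1) q & saddle K A1 A2 p q].
Proof.
have [C [txC yC]] := hybrid_bounded; have [r1 r2] := residual_cvg0.
have limP (G : set_system nat) : UltraFilter G -> \oo `<=` G ->
  exists p q, [/\ ultra_weak G tx p, ultra_weak G (fun k => y k.+1) q
                & saddle K A1 A2 p q].
  move=> GU oG; have [p txp] := bounded_ultra_weak GU txC.
  have [q yq] := bounded_ultra_weak GU yC.
  exists p, q; split => //.
  apply: (demiclosed Kbnd _ mA1 mA2 (a := a) (b := b) _ _ txC yC txp yq).
  - by move=> k; have [] := stepP k.
  - by move=> k; have [] := stepP k.
  - by move=> B /r1; exact: oG.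
  - by move=> B /r2; exact: oG.
have [G [GU oG]] := ultraFilterLemma (eventually_filter).
have [p [q [txp yq pq]]] := limP G GU oG.
exists p, q; split => //; apply: weakly_cvg_inner => h;
  apply: cvg_along_ultra => G' GU' oG'.
- have [p' [q' [txp' yq' pq']]] := limP G' GU' oG'.
  have [-> _] := ultra_limit_unique _ _ oG oG' pq pq' txp yq txp' yq'.
  exact: txp'.
- have [p' [q' [txp' yq' pq']]] := limP G' GU' oG'.
  have [_ ->] := ultra_limit_unique _ _ oG oG' pq pq' txp yq txp' yq'.
  exact: yq'.
Qed.

End hybrid_sequence.

Theorem theorem3p2 (R : realType) (H1 H2 : hilbertType R)
    (A1 : H1 -> set H1) (A2 : H2 -> set H2) (K : {linear H1 -> H2})
    (sigma tau theta : R) (x0 : H1) (y0 : H2)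
    (x : nat -> H1) (y : nat -> H2) (tx a : nat -> H1) (ty : nat -> H2) :
  maximal_monotone A1 ->
  maximal_monotone A2 ->
  bounded_near K (nbhs (0 : H1)) ->
  (exists xs : H1, primal_solution A1 A2 K xs) ->
  0 <= sigma < 1 ->
  0 < tau ->
  0 < theta ->
  tau * theta * opnorm K ^+ 2 <= 1 ->
  inexact_chambolle_pock A1 A2 K sigma tau theta x0 y0 x y tx a ty ->
  exists (xs : H1) (ys : H2),
    [/\ weakly_cvg (V := (H1 * H2)%type)
          (fun k : nat => (tx k.+1, ty k.+1)) (xs, ys),
        primal_dual_solution A1 A2 K xs ys,
        weakly_cvg (fun k : nat => tx k.+1) xs &
        primal_solution A1 A2 K xs].
Proof.
move=> mA1 mA2 Kbnd [p /primal_solution_saddle[q pq]] sigma01 tau_gt0 theta_gt0.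
move=> step_le1 [_ _ iter].
have /choice[b stepP] : forall k, exists b, hybrid_step K A1 A2 sigma tau theta
    (x k) (y k) (tx k.+1) (a k.+1) (y k.+1) b (x k.+1).
  move=> k; have [A1tx res err x'E yE] := iter k; rewrite yE.
  exact: chambolle_pock_hybrid_step.
have [xs [ys [txs tys sad]]] := hybrid_weak_cvg Kbnd tau_gt0 theta_gt0 step_le1
  sigma01 mA1 mA2 stepP pq.
have tyE : (fun k => y k.+1) = (fun k => ty k.+1).
  by apply/funext => k; have [] := iter k.
rewrite tyE in tys.
exists xs, ys; split => //.
- exact: weakly_cvg_pair.
- exact: saddle_dual_solution.
- exact: saddle_primal_solution sad.
Qed.
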